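(* There is no $c\in\mathbb{Q}$ with $h(c)\leq 8\log 10$ such that the quadratic polynomial $\varphi_c(z)=z^2+c$ has a $\mathbb{Q}$-rational periodic point with exact period greater than $3$.
   Context: For $c\in\mathbb{Q}$ put $\varphi_c(z)=z^2+c$, viewed as a self-map of $\mathbb{P}^1$ (the point at infinity is fixed). A point $\alpha\in\mathbb{P}^1(\mathbb{Q})$ is periodic with exact period $n\geq 1$ for $\varphi_c$ if $\varphi_c^n(\alpha)=\alpha$ while $\varphi_c^m(\alpha)\neq\alpha$ for $0<m<n$, where $\varphi_c^n$ denotes the $n$-th iterate. The logarithmic height on $\mathbb{Q}$ is $h(p/q)=\log(\max(|p|,|q|))$ for integers $p,q$ with $q\ne 0$ and $\gcd(p,q)=1$. *)

(* Defs.v *)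
From mathcomp Require Import all_boot all_order all_algebra.
From mathcomp Require Import reals exp.

Set Implicit Arguments.
Unset Strict Implicit.
Unset Printing Implicit Defensive.

Import Order.TTheory GRing.Theory Num.Theory.
Local Open Scope ring_scope.

(* P^1(Q) = Q + {oo}: [Some z] is the affine point z, [None] is infinity. *)
Definition P1Q : Type := option rat.

Definition phi (c : rat) (x : P1Q) : P1Q :=
  if x is Some z then Some (z ^+ 2 + c) else None.

Definition exact_period (T : Type) (f : T -> T) (n : nat) (x : T) : Prop :=
  [/\ (0 < n)%N, iter n f x = x
    & forall m : nat, (0 < m < n)%N -> iter m f x <> x].

(* [numq c] and [denq c] are the coprime numerator and denominator of c. *)
Definition height (R : realType) (c : rat) : R :=
  ln ((Num.max `|numq c| `|denq c|)%:~R).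

(* Main.v *)
Require Import Defs.
From Stdlib Require Import ZArith.
From mathcomp Require Import all_boot all_order all_algebra.
From mathcomp Require Import reals exp.
From mathcomp Require Import zify ssrZ ring.

Import Order.TTheory GRing.Theory Num.Theory.
Local Open Scope ring_scope.

(** Suppose that z^2 + c has a rational cycle of length n > 3.  Comparing
    denominators prime by prime, c = p / d^2 and the points of the cycle are
    m_i / d with m_i prime to d, so that d m_(i+1) = m_i^2 + p
    ([periodic_denq]).  Differences of these equations read
      (m_i - m_j) (m_i + m_j) = d (m_(i+1) - m_(j+1)),
    and multiplying them over the cycle gives
      prod_i (m_i + m_(i+k)) = d^n  for 0 < k < n,
    because the differences cancel.  Hence m_i + m_j has only prime factors of
    d.  If d were odd, the sum of any two of three points would be odd, which
    parity forbids; so d = 2 D, all m_i are odd, and with m_i = 2 h_i + 1,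
      x_i = h_i - h_(i+1),   a_i = h_i + h_(i+1) + 1
    one gets the recurrence
      D x_(i+1) = x_i a_i,   a_(i+1) = a_i - x_i - x_(i+1),
    with prod_i a_i = D^n.  The height bound gives D <= 5000, and it keeps the
    cycle in an interval where |x_i| and |a_i| are at most 16180.

    The |a_i| have geometric mean D without being all equal to D, so they drop
    somewhere: |a_i| >= D > |a_(i+1)| ([exists_drop_sum]).  At such a place the
    divisibility constraints are very rigid.  Put u = gcd(D, a_i), D = u v and
    a_i = e u A with e = 1 or -1.  As a_i + x_i = m_i is prime to D, no prime of D
    divides both a_i and x_i; so v is prime to u and divides x_i, say x_i = v t.
    With s = e (u - t) and N = A + e v everything is explicit:
      x_(i+1) = e A t,   a_(i+1) = N s - D,   h_i + h_(i+2) + 1 = A s.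
    The sums h_i + h_j + 1 divide D^n, so A has only primes of u and s only
    primes of v.  Moreover each p-part of v with p | s divides s, and the factor
    u1 of u = u1 u2, u2 = gcd(u, A), divides N.  Finally v <= A because
    |a_i| >= D, and 0 < N s < 2 D because |a_(i+1)| < D.  Fewer than 200000
    tuples (u2, v, A, e, u1, s) satisfy all this ([triple_not_survives] reduces
    a cycle to one of them), and for each of them the recurrence breaks off
    within six steps: a division by D is inexact, a value leaves the interval,
    or a point recurs after two or three steps.  This finite verification
    ([search_holds]) is evaluated in the kernel. *)

(** * Enumeration of the candidates *)

Section Search.

Local Open Scope Z_scope.

Local Notation "n %:Zb" := (Z.of_nat n) (at level 2, left associativity, format "n %:Zb").

Fixpoint forall_from (k : nat) (i : Z) (f : Z -> bool) : bool :=
  if k is k'.+1 then f i && forall_from k' (i + 1) f else true.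

Definition forall_upto (n : Z) : (Z -> bool) -> bool :=
  forall_from (Z.to_nat n) 1.

Fixpoint split_part (k : nat) (p n : Z) : Z * Z :=
  if k is k'.+1 then
    if n mod p =? 0 then
      let (q, r) := split_part k' p (n / p) in (p * q, r)
    else (1, n)
  else (1, n).

(** What is left after the primes of [ps] is taken to be prime, which is correct
    for n < 71^2 when [ps] is [small_primes]; the exponent bound 13 suffices
    since 5000 < 2^13.  The first entry of each pair is the prime, the second
    one its full power in [n]. *)
Fixpoint primary_factors (ps : seq Z) (n : Z) : seq (Z * Z) :=
  if n =? 1 then [::] else
  if ps is p :: ps' then
    if n mod p =? 0 then
      let (q, r) := split_part 13 p n in (p, q) :: primary_factors ps' r
    else primary_factors ps' n
  else [:: (n, n)].

Definition small_primes : seq Z :=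
  [:: 2; 3; 5; 7; 11; 13; 17; 19; 23; 29; 31; 37; 41; 43; 47; 53; 59; 61; 67].

Fixpoint multiples_by (k : nat) (p q B : Z) : seq Z :=
  if k is k'.+1 then
    if q <=? B then q :: multiples_by k' p (p * q) B else [::]
  else [::].

(** The numbers up to [B] composed of primes of [fs], in which every prime that
    occurs has at least the exponent that [fs] prescribes. *)
Fixpoint primary_products (fs : seq (Z * Z)) (B : Z) : seq Z :=
  if fs is (p, q) :: fs' then
    primary_products fs' B ++
    flatten [seq [seq t * s | s <- primary_products fs' (B / t)]
            | t <- multiples_by 14 p q B]
  else [:: 1].

(** The recurrence D y = x a, b = a - x - y, run for [k] steps, [w] being the
    value before [x].  A vanishing sum of two or three consecutive values of x
    means that a point recurs after two or three steps. *)
Fixpoint survives (k : nat) (D w x a : Z) : bool :=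
  if k is k'.+1 then
    if x * a mod D =? 0 then
      let y := x * a / D in
      let b := a - x - y in
      if Z.abs y <=? 16180 then
      if Z.abs b <=? 16180 then
      if x + y =? 0 then false else
      if w + x + y =? 0 then false else survives k' D x y b
      else false else false
    else false
  else true.

(** The test on t s is implied by the divisibility of (e A t) (N s - D) by v,
    hence by the first step of [survives]; it is much cheaper and discards most
    candidates. *)
Definition no_orbit (v A u D e N s : Z) : bool :=
  let t := u - e * s in
  if t * s mod v =? 0 then
    ~~ survives 6 D (v * t) (e * A * t) (N * s - D)
  else true.

Definition search_u1 (u2 v : Z) (fs : seq (Z * Z)) (A e N u1 : Z) : bool :=
  if N mod u1 =? 0 then
    let u := u1 * u2 in
    let D := u * v in
    all (no_orbit v A u D e N) (primary_products fs ((2 * D - 1) / N))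
  else true.

Definition search_sign (u2 v : Z) (fs : seq (Z * Z)) (A e : Z) : bool :=
  let N := A + e * v in
  if 0 <? N then
    forall_upto (Z.min (5000 / (u2 * v)) (16180 / (u2 * A)))
                (search_u1 u2 v fs A e N)
  else true.

Definition search_A (u2 v : Z) (fs : seq (Z * Z)) (A : Z) : bool :=
  if v <=? A then search_sign u2 v fs A 1 && search_sign u2 v fs A (-1)
  else true.

Definition search_v (u2 : Z) (As : seq Z) (v : Z) : bool :=
  if Z.gcd v u2 =? 1 then
    all (search_A u2 v (primary_factors small_primes v)) As
  else true.

Definition search_u2 (u2 : Z) : bool :=
  forall_upto (5000 / u2) (search_v u2
    [seq A <- primary_products (primary_factors small_primes u2) (16180 / u2)
    | A mod u2 =? 0]).

(** The bound 127 is enough because u2 divides A, so that u2^2 <= 16180. *)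
Lemma search_holds : forall_upto 127 search_u2.
Proof. by vm_cast_no_check (erefl true). Qed.

(** * Correctness of the enumeration *)

Lemma forall_fromP k i f (j : Z) :
  forall_from k i f -> i <= j < i + k%:Zb -> f j.
Proof.
elim: k i => [|k IHk] i /=; first by lia.
move=> /andP[fi fk] ij; case: (Z.eq_dec i j) => [<-//|ne_ij].
by apply: (IHk (i + 1)) => //; lia.
Qed.

Lemma forall_uptoP n f (j : Z) : forall_upto n f -> 1 <= j <= n -> f j.
Proof. by move=> fn jn; apply: forall_fromP fn _; lia. Qed.

Lemma of_nat_modn (n p : nat) : (0 < p)%N -> (n %% p)%N%:Zb = n%:Zb mod p%:Zb.
Proof.
move=> p_gt0; apply: (Z.mod_unique _ _ (n %/ p)%N%:Zb).
  by have := ltn_pmod n p_gt0; lia.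
by have := divn_eq n p; lia.
Qed.

Lemma of_nat_divn (n p : nat) : (0 < p)%N -> (n %/ p)%N%:Zb = n%:Zb / p%:Zb.
Proof.
move=> p_gt0; apply: (Z.div_unique _ _ _ (n %% p)%N%:Zb).
  by have := ltn_pmod n p_gt0; lia.
by have := divn_eq n p; lia.
Qed.

Lemma eqZ0_dvdn (n p : nat) : (0 < p)%N -> (n%:Zb mod p%:Zb =? 0) = (p %| n)%N.
Proof. by move=> p_gt0; rewrite -of_nat_modn// /dvdn; lia. Qed.

Lemma of_nat_coprime (m n : nat) : coprime m n -> Z.gcd m%:Zb n%:Zb = 1.
Proof.
move=> co_mn; have g_ge0 := Z.gcd_nonneg m%:Zb n%:Zb.
have dv k : (Z.gcd m%:Zb n%:Zb | k%:Zb) -> (Z.to_nat (Z.gcd m%:Zb n%:Zb) %| k)%N.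
  move=> [c Ec]; apply/dvdnP; exists (Z.to_nat c); apply: Nat2Z.inj.
  case: (Z_le_gt_dec 0 c) => c_sg; first by lia.
  have := Nat2Z.is_nonneg k.
  by lia.
have : (Z.to_nat (Z.gcd m%:Zb n%:Zb) %| gcdn m n)%N.
  by rewrite dvdn_gcd !dv//; [apply: Z.gcd_divide_r | apply: Z.gcd_divide_l].
by rewrite (eqP co_mn) dvdn1 => /eqP; lia.
Qed.

Lemma split_partP k (p n : nat) : prime p -> (0 < n < 2 ^ k)%N ->
  split_part k p%:Zb n%:Zb = ((n`_p)%N%:Zb, (n`_p^')%N%:Zb).
Proof.
move=> p_pr; elim: k n => [|k IHk] n /andP[n_gt0 ltn].
  by move: ltn; rewrite expn0; lia.
have p_gt1 := prime_gt1 p_pr.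
rewrite /= eqZ0_dvdn ?prime_gt0//; case: ifPn => [/dvdnP[m Em]|p_ndv]; last first.
  have p'n : (p^'.-nat n)%N by rewrite p'natE.
  by rewrite (part_p'nat p'n) (part_pnat_id p'n).
have m_gt0 : (0 < m)%N by case: (m) Em n_gt0 => [|//] ->; rewrite mul0n.
have -> : n%:Zb / p%:Zb = m%:Zb by rewrite -of_nat_divn ?prime_gt0// Em mulnK// prime_gt0.
rewrite IHk; last first.
  rewrite m_gt0 /=; move: ltn; rewrite Em expnS; nia.
have p_gt0 : (0 < p)%N by lia.
rewrite Em !partnM// (part_pnat_id (pnat_id p_pr)).
rewrite (@part_p'nat _ p); last by rewrite pnatNK pnat_id.
by rewrite muln1; congr (_, _); lia.
Qed.

Arguments split_part : simpl never.

Fixpoint lists_primary (fs : seq (Z * Z)) (n : nat) : Prop :=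
  if fs is (p, q) :: fs' then
    exists r : nat, [/\ prime r, p = r%:Zb, q = (n`_r)%N%:Zb, (r %| n)%N
                      & lists_primary fs' (n`_r^')%N]
  else n = 1%N.

Lemma small_primesP p : prime p -> (p < 71)%N -> p%:Zb \in small_primes.
Proof.
move=> p_pr p_lt.
have /allP/(_ p) : all (fun p => prime p ==> (p%:Zb \in small_primes)) (iota 0 71).
  by vm_compute.
by rewrite mem_iota p_pr; apply.
Qed.

(** Once all primes below 71 have been divided out, a remainder below
    71^2 = 5041 has no room for two prime factors. *)
Lemma lists_primary_factors (ps : seq nat) (n : nat) : all prime ps -> (0 < n < 5041)%N ->
    (forall p, prime p -> p %| n -> (p \in ps) || (71 <= p))%N ->
  lists_primary (primary_factors (map Z.of_nat ps) n%:Zb) n.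
Proof.
elim: ps n => [|p ps IHps] n /=.
  move=> _ /andP[n_gt0 n_lt] large; case: ifPn => [n1|n_neq1]; first by rewrite /=; lia.
  have n_pr : prime n.
    apply: ltn_pdiv2_prime => //.
    have n_gt1 : (1 < n)%N by lia.
    have /= := large (pdiv n) (pdiv_prime n_gt1) (pdiv_dvd n).
    by move=> pdiv_ge; apply: (leq_trans n_lt); rewrite (@leq_sqr 71).
  exists n; rewrite dvdnn; split=> //.
    by rewrite part_pnat_id// pnat_id.
  by rewrite part_p'nat//= pnatNK pnat_id.
move=> /andP[p_pr ps_pr] /andP[n_gt0 n_lt] large.
case: ifPn => [n1|n_neq1]; first by rewrite /=; lia.
have p_gt0 := prime_gt0 p_pr.
rewrite eqZ0_dvdn//; case: ifPn => [p_dv|p_ndv]; last first.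
  apply: IHps => //; first by rewrite n_gt0.
  move=> r r_pr r_dv; have := large r r_pr r_dv.
  by rewrite inE; case: eqP p_ndv r_dv => [-> /negP|].
rewrite split_partP//; last by rewrite n_gt0 /=; apply: (leq_trans n_lt).
exists p; split=> //; apply: IHps => //.
  by rewrite part_gt0 /= (leq_ltn_trans _ n_lt)// dvdn_leq// dvdn_part.
move=> r r_pr r_dv; have := large r r_pr (dvdn_trans r_dv (dvdn_part _ _)).
rewrite inE; case: eqP => // Er; move: r_dv; rewrite Er => p_dv'.
have /pnatP := part_pnat p^' n; move/(_ (part_gt0 _ _)) => /(_ p p_pr p_dv').
by rewrite inE /= inE eqxx.
Qed.

Lemma lists_primary_small (n : nat) : (0 < n <= 5000)%N ->
  lists_primary (primary_factors small_primes n%:Zb) n.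
Proof.
move=> /andP[n_gt0 n_le].
have -> : small_primes = map Z.of_nat (map Z.to_nat small_primes) by vm_compute.
apply: lists_primary_factors; first by vm_compute.
  by rewrite n_gt0 ltnS (leq_trans n_le).
move=> p p_pr _; case: (ltnP p 71) => p_lt; rewrite ?orbT// orbF.
apply/mapP; exists p%:Zb; last by lia.
exact: small_primesP.
Qed.


Lemma mem_multiples_by k p q i (B : Z) : (0 < p)%N -> (i < k)%N ->
  (p ^ i * q)%N%:Zb <= B -> (p ^ i * q)%N%:Zb \in multiples_by k p%:Zb q%:Zb B.
Proof.
move=> p_gt0; elim: k i q => [|k IHk] [|i] q //=.
  by rewrite expn0 mul1n => _ /Z.leb_le ->; rewrite inE eqxx.
rewrite ltnS => ik; rewrite expnSr -mulnA => le_B.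
have -> : (q%:Zb <=? B) = true.
  have : (q <= p ^ i * (p * q))%N by rewrite mulnA leq_pmull// muln_gt0 expn_gt0 p_gt0.
  by move: le_B; set z := (_ * (p * q))%N; lia.
by rewrite inE -Nat2Z.inj_mul; apply/orP; right; apply: IHk.
Qed.

Arguments multiples_by : simpl never.

(** Induction over the primes of [v]: strip from [s] its r-part, which is either
    trivial or a multiple of the r-part of [v]. *)
Lemma mem_primary_products fs v s (B : Z) : lists_primary fs v ->
    (0 < v)%N -> (0 < s)%N -> s%:Zb <= B -> B < 16384 ->
    (forall p, prime p -> p %| s -> (p %| v) && ((v`_p)%N %| s))%N ->
  s%:Zb \in primary_products fs B.
Proof.
elim: fs v s B => [|[p q] fs IHfs] v s B /=.
  move=> -> _ s_gt0 _ _ s_v; rewrite inE; apply/eqP.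
  suff -> : s = 1%N by [].
  apply/eqP; apply: contraT => s_neq1.
  have s_gt1 : (1 < s)%N by lia.
  have /andP[] := s_v _ (pdiv_prime s_gt1) (pdiv_dvd s).
  by rewrite dvdn1 => /eqP pdiv1; have := prime_gt1 (pdiv_prime s_gt1); rewrite pdiv1.
move=> [r [r_pr -> -> r_v fs_v]] v_gt0 s_gt0 s_B B_lt s_v.
have r_gt1 := prime_gt1 r_pr.
rewrite mem_cat; apply/orP; set w := (s`_r^')%N.
have w_v p' : prime p' -> (p' %| w)%N -> ((p' %| v`_r^') && ((v`_r^')`_p' %| w))%N.
  move=> p'_pr p'_w.
  have p'_neq : p' != r.
    apply: contraTneq p'_w => ->; rewrite -p'natE//; exact: part_pnat.
  have /andP[p'_v v_s] := s_v _ p'_pr (dvdn_trans p'_w (dvdn_part _ _)).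
  have p'C : (r^'.-nat p')%N by rewrite pnatE// inE /= inE.
  have E : ((v`_r^')`_p' = v`_p')%N.
    rewrite -partnI; apply: eq_in_partn => x _; rewrite !inE.
    by case: (eqVneq x p') => [->|_]; rewrite ?p'_neq ?andbF.
  rewrite E; apply/andP; split.
    by rewrite -(part_pnat_id p'C); apply: partn_dvd.
  have vC : (r^'.-nat v`_p')%N by rewrite -E; apply: pnat_dvd (dvdn_part _ _) (part_pnat _ _).
  by rewrite -(part_pnat_id vC); apply: partn_dvd.
have w_gt0 : (0 < w)%N by apply: part_gt0.
have [r_s|r_ns] := boolP (r %| s)%N; last first.
  left; have ws : w = s by rewrite /w part_pnat_id// p'natE.
  by rewrite -ws; apply: (IHfs _ _ _ fs_v) => //; rewrite ?ws// part_gt0.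
right; have /andP[_ vr_s] := s_v _ r_pr r_s.
have sE : s = (s`_r * w)%N by rewrite /w partnC.
have sr_s : (s`_r <= s)%N by rewrite dvdn_leq// dvdn_part.
have vr_sr : (v`_r %| s`_r)%N.
  by rewrite -(part_pnat_id (part_pnat r v)); apply: partn_dvd.
have [i srE] : exists i, (s`_r = r ^ i * v`_r)%N.
  exists (logn r s - logn r v)%N; rewrite !p_part -expnD subnK//.
  by rewrite -(dvdn_Pexp2l _ _ r_gt1)// -!p_part.
apply/flattenP.
exists [seq (s`_r)%N%:Zb * z | z <- primary_products fs (B / (s`_r)%N%:Zb)].
  apply/mapP; exists (s`_r)%N%:Zb => //; rewrite srE; apply: mem_multiples_by; first lia.
    rewrite -(@ltn_exp2l 2)//.
    have : (2 ^ i <= r ^ i)%N by case: (i) => [//|j]; rewrite leq_exp2r.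
    have : (r ^ i <= s`_r)%N by rewrite srE leq_pmulr// part_gt0.
    have : (2 ^ 14)%N%:Zb = 16384 by vm_compute.
    by move: (2 ^ 14)%N (2 ^ i)%N (r ^ i)%N => c1 c2 c3; lia.
  by rewrite -srE; lia.
apply/mapP; exists w%:Zb; last by rewrite {1}sE; lia.
apply: (IHfs _ _ _ fs_v) => //.
  apply: Z.div_le_lower_bound; last by rewrite {1}sE in s_B; lia.
  by have := part_gt0 r s; lia.
have sr_gt0 := part_gt0 r s.
by apply: (Z.le_lt_trans _ B) => //; apply: Z.div_le_upper_bound; nia.
Qed.


(** The division in [survives] is exact along an actual orbit, so the run
    follows the orbit and none of its tests fails. *)
Lemma survives_orbit k (D : Z) (x a : nat -> Z) :
    D <> 0 ->
    (forall i, x i * a i = D * x i.+1) ->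
    (forall i, a i.+1 = a i - x i - x i.+1) ->
    (forall i, Z.abs (x i) <= 16180) -> (forall i, Z.abs (a i) <= 16180) ->
    (forall i, x i + x i.+1 <> 0) -> (forall i, x i + x i.+1 + x i.+2 <> 0) ->
  forall i, survives k D (x i) (x i.+1) (a i.+1).
Proof.
move=> D_neq0 xa aS x_le a_le x2 x3; elim: k => //= k IHk i.
rewrite xa Z.mul_comm Z.mod_mul// Z.div_mul// -aS /=.
rewrite (Zle_imp_le_bool _ _ (x_le _)) (Zle_imp_le_bool _ _ (a_le _)).
by rewrite (proj2 (Z.eqb_neq _ _) (x2 _)) (proj2 (Z.eqb_neq _ _) (x3 _)).
Qed.

(** The hypotheses are the constraints that cut down the enumeration, written
    with the letters of the introduction. *)
Lemma search_complete (u1 u2 v A s : nat) (e u D N t : Z) :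
    e = 1 \/ e = -1 ->
    (0 < u1)%N -> (0 < u2)%N -> (0 < v)%N -> (0 < s)%N ->
    u = u1%:Zb * u2%:Zb -> D = u * v%:Zb -> N = A%:Zb + e * v%:Zb ->
    t = u - e * s%:Zb ->
    D <= 5000 -> u * A%:Zb <= 16180 ->
    (v <= A)%N -> coprime v u2 -> (u2 %| A)%N ->
    (forall p, prime p -> p %| A -> p %| u2)%N ->
    (forall p, prime p -> p %| s -> (p %| v) && ((v`_p)%N %| s))%N ->
    0 < N -> N mod u1%:Zb = 0 -> N * s%:Zb < 2 * D -> t * s%:Zb mod v%:Zb = 0 ->
  ~~ survives 6 D (v%:Zb * t) (e * A%:Zb * t) (N * s%:Zb - D).
Proof.
move=> e_sg u1_gt0 u2_gt0 v_gt0 s_gt0 Eu ED EN Et D_le a_le v_A co_v_u2 u2_A A_u2.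
move=> s_v N_gt0 N_u1 Ns_lt ts_v.
have A_gt0 : (0 < A)%N by lia.
have u2_le_A : (u2 <= A)%N by apply: dvdn_leq.
have u2A_le : u2%:Zb * A%:Zb <= 16180 by nia.
have u2v_le : u2%:Zb * v%:Zb <= 5000 by nia.
have u2_lt : 1 <= u2%:Zb <= 127 by nia.
have v_le : 1 <= v%:Zb <= 5000 / u2%:Zb.
  by split; first lia; apply: Z.div_le_lower_bound; lia.
have u2_le : (0 < u2 <= 5000)%N by rewrite u2_gt0; lia.
have v_le' : (0 < v <= 5000)%N by rewrite v_gt0; nia.
have As_A : A%:Zb \in [seq A <- primary_products
    (primary_factors small_primes u2%:Zb) (16180 / u2%:Zb) | A mod u2%:Zb =? 0].
  rewrite mem_filter eqZ0_dvdn// u2_A andTb.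
  apply: (mem_primary_products _ _ _ _ (lists_primary_small _ u2_le)) => //.
  - by apply: Z.div_le_lower_bound; lia.
  - by apply: Z.div_lt_upper_bound; lia.
  - move=> p p_pr p_A; rewrite A_u2//=.
    exact: dvdn_trans (dvdn_part _ _) u2_A.
have ss_s : s%:Zb \in primary_products (primary_factors small_primes v%:Zb)
                                       ((2 * D - 1) / N).
  apply: (mem_primary_products _ _ _ _ (lists_primary_small _ v_le')) => //.
  - by apply: Z.div_le_lower_bound; lia.
  - by apply: Z.div_lt_upper_bound; nia.
have := forall_uptoP _ _ _ search_holds u2_lt; rewrite /search_u2.
move=> /(forall_uptoP _ _ _)/(_ v_le); rewrite /search_v (of_nat_coprime _ _ co_v_u2).
have v_leb : (v%:Zb <=? A%:Zb) = true by lia.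
rewrite Z.eqb_refl => /allP/(_ _ As_A); rewrite /search_A v_leb => /andP[search1 search2].
have : search_sign u2%:Zb v%:Zb (primary_factors small_primes v%:Zb) A%:Zb e.
  by case: e_sg => ->.
rewrite /search_sign -EN (proj2 (Z.ltb_lt _ _) N_gt0).
have u1_le : 1 <= u1%:Zb <= Z.min (5000 / (u2%:Zb * v%:Zb)) (16180 / (u2%:Zb * A%:Zb)).
  split; first lia; apply: Z.min_glb; apply: Z.div_le_lower_bound; nia.
move=> /(forall_uptoP _ _ _)/(_ u1_le); rewrite /search_u1 N_u1 -Eu -ED.
by rewrite Z.eqb_refl => /allP/(_ _ ss_s); rewrite /no_orbit -Et ts_v.
Qed.

End Search.

(** * The arithmetic of three consecutive points *)

(** A prime of [D] cannot divide both [a] and [x], so one of the two takes the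
    whole power of that prime in [D]. *)
Lemma split_denominator (D : nat) (a x y : int) :
    (0 < D)%N -> x * a = D%:Z * y -> coprime D `|a + x| ->
  let u := gcdn D `|a| in let v := (D %/ u)%N in
  [/\ D = (u * v)%N, coprime u v & (v%:Z %| x)%Z].
Proof.
move=> D_gt0 xa co_D u v.
have u_gt0 : (0 < u)%N by rewrite gcdn_gt0 D_gt0.
have Duv : D = (u * v)%N by rewrite mulnC divnK// dvdn_gcdl.
have /dvdnP[A aE] : (u %| `|a|)%N by apply: dvdn_gcdr.
have co_vA : coprime v A.
  have : (u * gcdn v A)%N = u by rewrite muln_gcdr -Duv (mulnC u A) -aE.
  move/eqP; rewrite -[X in _ == X]muln1 eqn_pmul2l//.
have v_x : (v %| `|x|)%N.
  have : (u * (`|x| * A))%N = (u * (v * `|y|))%N.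
    have := congr1 absz xa; rewrite !abszM absz_nat aE {1}Duv; lia.
  move/eqP; rewrite eqn_pmul2l// => /eqP xA.
  by rewrite -(Gauss_dvdl _ co_vA) xA dvdn_mulr.
split; rewrite ?dvdzE//.
rewrite /coprime -dvdn1 -(eqP co_D) dvdn_gcd; apply/andP; split.
  by apply: (dvdn_trans (dvdn_gcdl _ _)); apply: dvdn_gcdl.
have d_a : ((gcdn u v)%:Z %| a)%Z.
  by rewrite dvdzE (dvdn_trans (dvdn_gcdl _ _))// dvdn_gcdr.
have d_x : ((gcdn u v)%:Z %| x)%Z.
  by rewrite dvdzE (dvdn_trans (dvdn_gcdr _ _)).
by have := rpredD d_a d_x; rewrite [_ \in _]dvdzE.
Qed.

Lemma Z_mod_dvdz (d : nat) (z : int) : (0 < d)%N -> (d%:Z %| z)%Z ->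
  Z.modulo (Z_of_int z) (Z.of_nat d) = Z0.
Proof.
move=> d_gt0 /dvdzP[q ->].
have -> : Z_of_int (q * d%:Z) = Z.mul (Z_of_int q) (Z.of_nat d) by lia.
by apply: Z.mod_mul; lia.
Qed.

(** Here (a, x) and (b, y) belong to the consecutive pairs of points (0, 1) and
    (1, 2), and (a - y, x + y) to the pair (0, 2): a - y is half the sum, and
    x + y half the difference, of the points 0 and 2.  [split_denominator]
    applied to these three pairs yields all the constraints. *)
Lemma triple_not_survives (D k : nat) (a b x y z w : int) :
    (0 < D)%N -> Z.le (Z.of_nat D) 5000 ->
    x * a = D%:Z * y -> y * b = D%:Z * z -> (x + y) * (a - y) = D%:Z * w ->
    b = a - x - y -> x + y != 0 ->
    coprime D `|a + x| -> coprime D `|b + y| ->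
    (`|a| %| D ^ k)%N -> (`|a - y| %| D ^ k)%N ->
    (D <= `|a|)%N -> Z.le (Z.of_nat `|a|) 16180 -> (`|b| < D)%N ->
  ~~ survives 6 (Z.of_nat D) (Z_of_int x) (Z_of_int y) (Z_of_int b).
Proof.
move=> D_gt0 D_le xa yb xyg bE xy_neq0 co_ax co_by a_D g_D D_a a_le b_D.
have [Duv co_uv v_x] := split_denominator _ _ _ _ D_gt0 xa co_ax.
set u := gcdn D `|a| in Duv co_uv v_x; set v := (D %/ u)%N in Duv co_uv v_x.
have [DB co_B vB_y] := split_denominator _ _ _ _ D_gt0 yb co_by.
set uB := gcdn D `|b| in DB co_B vB_y; set vB := (D %/ uB)%N in DB co_B vB_y.
have co_g : coprime D `|(a - y) + (x + y)|.
  by have -> : a - y + (x + y) = a + x by ring.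
have [DG co_G vG_xy] := split_denominator _ _ _ _ D_gt0 xyg co_g.
set uG := gcdn D `|a - y| in DG co_G vG_xy.
set vG := (D %/ uG)%N in DG co_G vG_xy.
have u_gt0 : (0 < u)%N by rewrite gcdn_gt0 D_gt0.
have v_gt0 : (0 < v)%N by move: D_gt0; rewrite Duv; case: (v) => //; rewrite muln0.
have a_neq0 : a != 0 by rewrite -absz_gt0 (leq_trans D_gt0).
have /dvdnP[A aE] : (u %| `|a|)%N by apply: dvdn_gcdr.
have A_gt0 : (0 < A)%N by case: (A) aE => // a0; rewrite -absz_eq0 a0 in a_neq0.
have co_vA : coprime v A.
  have : (u * gcdn v A)%N = u by rewrite muln_gcdr -Duv (mulnC u A) -aE.
  by move/eqP; rewrite -[X in _ == X]muln1 eqn_pmul2l.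
have [e [e_sg aeE]] : exists e : int, (e = 1 \/ e = -1) /\ a = e * (u%:Z * A%:Z).
  exists (sgz a); split.
    case: (ltgtP a 0) a_neq0 => [a_lt0|a_gt0|->//] _.
      by right; rewrite ltr0_sgz.
    by left; rewrite gtr0_sgz.
  rewrite {1}[a]intEsg -PoszM mulnC -aE //.
have e2 : e * e = 1 by case: e_sg => ->.
have /dvdzP[t xE] := v_x.
have yE : y = e * A%:Z * t.
  have D_neq0 : D%:Z != 0 by lia.
  apply: (mulfI D_neq0); rewrite -xa xE aeE Duv PoszM; ring.
have co_ut : coprime u `|t|.
  rewrite /coprime -dvdn1 -(eqP co_ax) dvdn_gcd; apply/andP; split.
    by apply: (dvdn_trans (dvdn_gcdl _ _)); apply: dvdn_gcdl.
  have d_u : ((gcdn u `|t|)%:Z %| a)%Z.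
    by rewrite dvdzE (dvdn_trans (dvdn_gcdl _ _))// dvdn_gcdr.
  have d_x : ((gcdn u `|t|)%:Z %| x)%Z.
    by rewrite xE; apply: dvdz_mulr; rewrite dvdzE dvdn_gcdr.
  by have := rpredD d_u d_x; rewrite [_ \in _]dvdzE.
(* Primes of u2 recur in A; those of u1 occur in a exactly as in D. *)
set u2 := gcdn u A.
have u2_gt0 : (0 < u2)%N by rewrite gcdn_gt0 u_gt0.
have /dvdnP[u1 uE] : (u2 %| u)%N by apply: dvdn_gcdl.
have u1_gt0 : (0 < u1)%N by case: (u1) uE u_gt0 => // ->; rewrite mul0n.
pose N : int := A%:Z + e * v%:Z; pose si : int := u%:Z - t.
have xyE : x + y = e * N * t by rewrite xE yE /N mulrDr mulrA e2 mul1r; ring.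
have gE : a - y = e * A%:Z * si by rewrite aeE yE /si; ring.
have bDE : b + D%:Z = e * N * si.
  rewrite bE aeE xE yE Duv PoszM /N /si.
  rewrite (mulrDr e) (mulrA e e) e2; ring.
have N_neq0 : N != 0 by apply: contraNneq xy_neq0 => N0; rewrite xyE N0 mulr0 mul0r.
have v_A : (v <= A)%N.
  by move: D_a; rewrite aE Duv mulnC leq_pmul2r.
have N_gt0 : 0 < N.
  by move: e_sg N_neq0 v_A v_gt0; rewrite /N; clear; move: v => v'; case=> ->; lia.
have esi_gt0 : 0 < e * si.
  have : 0 < b + D%:Z by move: b_D; clear; lia.
  by rewrite bDE mulrAC pmulr_lgt0.
have [s sE] : exists s : nat, e * si = s%:Z by exists `|(e * si)%R|%N; rewrite gez0_abs// ltW.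
have siE : si = e * s%:Z by rewrite -sE mulrA e2 mul1r.
have s_gt0 : (0 < s)%N by rewrite -ltz_nat -sE.
have absg : `|a - y|%N = (A * s)%N.
  by rewrite gE siE mulrACA e2 mul1r abszM.
have bDN : b + D%:Z = N * s%:Z by rewrite bDE mulrAC sE mulrC.
have tE : t = u%:Z - e * s%:Z by rewrite -siE /si; ring.
(* The part of u that meets vB divides y = e A t, hence A, hence u2; so u1
   lies in the part uB of D that divides b. *)
have u1_b : (u1 %| `|b|)%N.
  have h_dv : (gcdn u vB %| u2)%N.
    rewrite dvdn_gcd dvdn_gcdl /= -(@Gauss_dvdl _ _ `|t|).
      have : (gcdn u vB %| `|y|)%N by apply: dvdn_trans (dvdn_gcdr _ _) _; rewrite dvdzE in vB_y.
      by rewrite yE -mulrA !abszM; case: e_sg => ->; rewrite mul1n.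
    by apply: coprime_dvdl co_ut; apply: dvdn_gcdl.
  have h_gt0 : (0 < gcdn u vB)%N by rewrite gcdn_gt0 u_gt0.
  apply: (@dvdn_trans (u %/ gcdn u vB)).
    by rewrite dvdn_divRL ?dvdn_gcdl// {2}uE dvdn_mul.
  apply: (@dvdn_trans uB); last exact: dvdn_gcdr.
  have u_DB : (u %| uB * vB)%N by rewrite -DB; apply: dvdn_gcdl.
  rewrite -(@Gauss_dvdl _ _ (vB %/ gcdn u vB)).
    have h_DB : (gcdn u vB %| uB * vB)%N by rewrite dvdn_mull// dvdn_gcdr.
    by rewrite muln_divA ?dvdn_gcdr// dvdn_divRL// divnK// dvdn_gcdl.
  rewrite /coprime -(eqn_pmul2r h_gt0) muln_gcdl !divnK ?dvdn_gcdl ?dvdn_gcdr//.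
  by rewrite mul1n.
have u1_a : (u1 %| `|a|)%N.
  by apply: (@dvdn_trans u); [rewrite uE dvdn_mulr | apply: dvdn_gcdr].
have u1_N : (u1%:Z %| N)%Z.
  have : (u1%:Z %| a - b)%Z by apply: rpredB; rewrite [_ \in _]dvdzE.
  rewrite (_ : a - b = x + y); last by rewrite bE; ring.
  rewrite xyE Gauss_dvdzl; last first.
    by rewrite /coprimez; apply: (coprime_dvdl _ co_ut); rewrite uE dvdn_mulr.
  by case: e_sg => ->; rewrite ?mul1r// mulN1r rpredN.
(* A prime of s cannot divide u, as it would divide t = u - e s as well; and
   since it divides a - y = e A s, so does its full power in D. *)
have s_v p : prime p -> (p %| s)%N -> ((p %| v) && (v`_p %| s))%N.
  move=> p_pr p_s.
  have p_g : (p %| `|a - y|)%N by rewrite absg dvdn_mull.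
  have p_D : (p %| D)%N.
    by move: (dvdn_trans p_g g_D); rewrite Euclid_dvdX// => /andP[].
  have p_nu : ~~ (p %| u)%N.
    apply/negP => p_u; have : (p %| gcdn u `|t|)%N.
      rewrite dvdn_gcd p_u /=; have : (p%:Z %| t)%Z.
        rewrite tE; apply: rpredB; first by rewrite [_ \in _]dvdzE.
        by apply: dvdz_mull; rewrite dvdzE.
      by rewrite dvdzE.
    by rewrite (eqP co_ut) dvdn1 => /eqP p1; rewrite p1 in p_pr.
  have p_v : (p %| v)%N by move: p_D; rewrite Duv Euclid_dvdM// (negPf p_nu).
  rewrite p_v /=.
  have p_uG : (p %| uG)%N by rewrite dvdn_gcd p_D.
  have co_part m : coprime p m -> coprime (v`_p) m.
    by move=> co; rewrite p_part coprimeXl.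
  have : (v`_p %| uG * vG)%N.
    by rewrite -DG; apply: (dvdn_trans (dvdn_part _ _)); rewrite Duv dvdn_mull.
  rewrite Gauss_dvdl; last first.
    by apply: co_part; apply: coprime_dvdl co_G.
  move=> /dvdn_trans/(_ (dvdn_gcdr _ _)); rewrite absg Gauss_dvdr//.
  by apply: co_part; apply: coprime_dvdl co_vA.
have A_u2 p : prime p -> (p %| A)%N -> (p %| u2)%N.
  move=> p_pr p_A; rewrite dvdn_gcd p_A andbT.
  have p_a : (p %| `|a|)%N by rewrite aE dvdn_mulr.
  have : (p %| D)%N by move: (dvdn_trans p_a a_D); rewrite Euclid_dvdX// => /andP[].
  rewrite Duv Euclid_dvdM// => /orP[//|p_v].
  have : (p %| gcdn v A)%N by rewrite dvdn_gcd p_v.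
  by rewrite (eqP co_vA) dvdn1 => /eqP p1; rewrite p1 in p_pr.
(* Modulo v, y b = e A t (N s - D) is e A^2 t s, and v is prime to A. *)
have v_ts : (v%:Z %| t * s%:Z)%Z.
  have : (D%:Z %| y * b)%Z by rewrite yb dvdz_mulr.
  have -> : y * b = A%:Z * (A%:Z * (e * (t * s%:Z)))
                  + v%:Z * (A%:Z * t * s%:Z - e * A%:Z * t * u%:Z).
    have -> : b = N * s%:Z - D%:Z by rewrite -bDN addrK.
    by rewrite yE /N Duv PoszM; case: e_sg => ->; ring.
  rewrite Duv PoszM => /(dvdz_trans (dvdz_mull _ (dvdzz _))).
  rewrite rpredDr; last by apply: dvdz_mulr; apply: dvdzz.
  rewrite [_ \in _]dvdzE dvdzE !abszM !absz_nat 2!(Gauss_dvdr _ co_vA).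
  by case: e_sg => ->; rewrite mul1n.
have co_vu2 : coprime v u2.
  by rewrite coprime_sym; apply: coprime_dvdl co_uv; rewrite uE dvdn_mull.
have -> : Z_of_int x = Z.mul (Z.of_nat v) (Z_of_int t).
  by rewrite xE; clear; lia.
have -> : Z_of_int y = Z.mul (Z.mul (Z_of_int e) (Z.of_nat A)) (Z_of_int t).
  by rewrite yE; clear; lia.
have -> : Z_of_int b = Z.sub (Z.mul (Z_of_int N) (Z.of_nat s)) (Z.of_nat D).
  by move: bDN; clear; move: N; lia.
apply: (search_complete u1 u2 v A s (Z_of_int e) (Z.of_nat u) (Z.of_nat D) (Z_of_int N)) => //.
- by case: e_sg => ->; [left | right].
- by rewrite uE; clear; lia.
- by rewrite {1}Duv; clear; lia.
- by rewrite /N; clear; lia.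
- by rewrite tE; clear; lia.
- by move: a_le; rewrite aE; clear; lia.
- exact: dvdn_gcdr.
- by move: N_gt0; clear; move: N; lia.
- exact: Z_mod_dvdz.
- by move: b_D bDN; clear; move: N; lia.
- have -> : Z.mul (Z_of_int t) (Z.of_nat s) = Z_of_int (t * s%:Z) by clear; lia.
  exact: Z_mod_dvdz.
Qed.

(** * Cycles *)

(** Multiplying the relations telescopes the x i, and around a cycle they
    cancel. *)
Lemma prod_cycle (n : nat) (d : int) (x s : nat -> int) :
    (forall i, x i * s i = d * x i.+1) -> x n = x 0%N -> x 0%N != 0 ->
  \prod_(i < n) s i = d ^+ n.
Proof.
move=> xs xn x0_neq0; apply: (mulfI x0_neq0).
suff -> k : x 0%N * \prod_(i < k) s i = d ^+ k * x k by rewrite xn mulrC.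
elim: k => [|k IHk]; first by rewrite big_ord0 mulrC.
by rewrite big_ord_recr /= mulrA IHk -mulrA xs exprSr mulrA.
Qed.

Lemma periodicM (T : Type) (f : nat -> T) n i k :
  (forall i, f (i + n)%N = f i) -> f (i + k * n)%N = f i.
Proof. by move=> fn; elim: k => [|k IHk]; rewrite ?addn0// mulSn addnCA addnC fn. Qed.

Lemma cycle_factor_dvd (n d : nat) (x s : nat -> int) :
    (0 < n)%N -> (forall i, x (i + n)%N = x i) -> (forall i, s (i + n)%N = s i) ->
    (forall i, x i * s i = d%:Z * x i.+1) -> x 0%N != 0 ->
  forall i, (`|s i| %| d ^ n)%N.
Proof.
move=> n_gt0 xn sn xs x0_neq0 i.
rewrite (divn_eq i n) addnC periodicM//.
have -> : (d ^ n)%N = `|d%:Z ^+ n|%N by rewrite abszX.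
rewrite -(prod_cycle n d%:Z x s) ?xn//; last by rewrite -[n]add0n xn.
by rewrite (bigD1 (Ordinal (ltn_pmod i n_gt0)))//= abszM dvdn_mulr.
Qed.

Lemma leq_prod_eq (n D : nat) (a : nat -> nat) :
    (forall i, D <= a i)%N -> (0 < D)%N -> (\prod_(i < n) a i = D ^ n)%N ->
  forall i, (i < n)%N -> a i = D.
Proof.
move=> D_a D_gt0.
have le_prod k : (D ^ k <= \prod_(i < k) a i)%N.
  elim: k => [|k IHk]; first by rewrite big_ord0.
  by rewrite big_ord_recr expnSr leq_mul.
elim: n => [//|n IHn]; rewrite big_ord_recr expnSr /= => prodE i.
have an : a n = D.
  apply/eqP; rewrite eqn_leq D_a andbT -(@leq_pmul2l (D ^ n)) ?expn_gt0 ?D_gt0//.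
  by rewrite -prodE leq_mul.
rewrite ltnS leq_eqVlt => /predU1P[->//|]; apply: IHn.
by move: prodE; rewrite an => /eqP; rewrite eqn_pmul2r// => /eqP.
Qed.

(** Without a drop below [D], one value at least [D] forces all the following
    ones, hence by periodicity all values, to be at least [D]; the product then
    makes them equal to [D].  If there is no such value, the product is too
    small. *)
Lemma exists_drop (n D : nat) (a : nat -> nat) :
    (0 < n)%N -> (0 < D)%N -> (forall i, a (i + n)%N = a i) ->
    (\prod_(i < n) a i = D ^ n)%N ->
  (exists i, (D <= a i)%N && (a i.+1 < D)%N) \/ (forall i, a i = D).
Proof.
move=> n_gt0 D_gt0 an prodE.
have [/existsP[i]|] := boolP [exists i : 'I_n, (D <= a i) && (a i.+1 < D)]%N.
  by left; exists i.
rewrite negb_exists => /forallP no_drop; right.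
have step i : (D <= a i -> D <= a i.+1)%N.
  rewrite (divn_eq i n) addnC -addSn !periodicM// => D_ai.
  by have := no_drop (Ordinal (ltn_pmod i n_gt0)); rewrite /= D_ai -leqNgt.
have stepk i k : (D <= a i -> D <= a (i + k))%N.
  by move=> D_ai; elim: k => [|k IHk]; rewrite ?addn0// addnS step.
have [/existsP[i0 D_i0]|] := boolP [exists i : 'I_n, (D <= a i)]%N.
  have D_a i : (D <= a i)%N.
    rewrite -(periodicM _ a n i i0 an).
    have le_i0 : (i0 <= i + i0 * n)%N by rewrite (leq_trans _ (leq_addl _ _))// leq_pmulr.
    by rewrite -(subnKC le_i0) stepk.
  move=> i; rewrite (divn_eq i n) addnC periodicM//.
  by apply: leq_prod_eq prodE _ _ => //; rewrite ltn_pmod.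
rewrite negb_exists => /forallP a_D.
have : (\prod_(i < n) a i < D ^ n)%N; last by rewrite prodE ltnn.
case: n n_gt0 a_D {an prodE no_drop step} => // n _ a_D.
rewrite big_ord_recr expnSr /=.
have : (\prod_(i < n) a (widen_ord (leqnSn n) i) <= \prod_(i < n) D)%N.
  by apply: leq_prod => i _; rewrite ltnW// ltnNge a_D.
rewrite prod_nat_const card_ord => le_Dn; apply: (leq_ltn_trans (leq_mul le_Dn (leqnn _))).
by rewrite ltn_pmul2l ?expn_gt0 ?D_gt0// ltnNge (a_D ord_max).
Qed.

(** In this section the cycle is described by the h_i with m_i = 2 h_i + 1, so
    that half sums and half differences of the m_i need no division. *)
Section Cycle.

Variables (D n : nat) (h : nat -> int).

Hypothesis D_gt0 : (0 < D)%N.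
Hypothesis D_le : Z.le (Z.of_nat D) 5000.
Hypothesis n_gt3 : (3 < n)%N.
Hypothesis hn : forall i, h (i + n)%N = h i.
Hypothesis h_neq : forall i k, (0 < k < n)%N -> h (i + k)%N != h i.
Hypothesis h_step : forall i j,
  (h i - h j) * (h i + h j + 1) = D%:Z * (h i.+1 - h j.+1).
Hypothesis h_coprime : forall i, coprime D `|(h i *+ 2 + 1)%R|.
Hypothesis h_small : forall i j, Z.le (Z.of_nat `|(h i - h j)%R|) 16180.
Hypothesis h_small' : forall i j, Z.le (Z.of_nat `|(h i + h j + 1)%R|) 16180.

Let x i : int := h i - h i.+1.
Let a i : int := h i + h i.+1 + 1.

Lemma prod_sum k : (0 < k < n)%N ->
  \prod_(i < n) (h i + h (i + k)%N + 1) = D%:Z ^+ n.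
Proof.
move=> k_n; apply: (prod_cycle n D%:Z (fun i => h i - h (i + k)%N)
                     (fun i => h i + h (i + k)%N + 1)) => [i||].
- by rewrite h_step addSn.
- by rewrite -[n]add0n addnAC !hn.
- by rewrite subr_eq0 eq_sym h_neq.
Qed.

Lemma sum_dvd k i : (0 < k < n)%N -> (`|(h i + h (i + k)%N + 1)%R| %| D ^ n)%N.
Proof.
move=> k_n.
apply: (cycle_factor_dvd n D (fun i => h i - h (i + k)%N)
                             (fun i => h i + h (i + k)%N + 1)) => [|j|j|j|].
- exact: ltn_trans n_gt3.
- by rewrite addnAC !hn.
- by rewrite addnAC !hn.
- by rewrite h_step addSn.
- by rewrite subr_eq0 eq_sym h_neq.
Qed.

(** If all |a i| were equal to [D], then x (i+1) = x i or - x i.  The minus sign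
    would give h (i+2) = h i, so the h i would form an arithmetic progression,
    which cannot be periodic. *)
Lemma exists_drop_sum : exists i, (D <= `|a i|)%N && (`|a i.+1| < D)%N.
Proof.
have n_gt0 : (0 < n)%N by apply: ltn_trans n_gt3.
case: (@exists_drop n D (fun i => `|a i|%N)) => //.
- by move=> i; rewrite /a -addSn !hn.
- have k1 : (0 < 1 < n)%N by lia.
  have := congr1 absz (prod_sum 1 k1); rewrite abszX absz_nat => <-.
  rewrite (big_morph absz abszM (erefl : absz 1 = 1%N)).
  by apply: eq_bigr => i _; rewrite addn1.
move=> aD.
have xS i : x i.+1 = x i.
  have := h_step i i.+1; rewrite -/(x i) -/(a i) -/(x i.+1).
  have k2 : (0 < 2 < n)%N by lia.
  have := h_neq i 2 k2; rewrite addn2.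
  have : x i + x i.+1 = h i - h i.+2 by rewrite /x; ring.
  move: (aD i) D_gt0; clear; move: (x i) (x i.+1) (a i) (h i) (h i.+2) => x0 x1 a0 h0 h2.
  move=> aD D_gt0 xE h20 xa.
  have [aE|aE] : a0 = D%:Z \/ a0 = - D%:Z by lia.
    have D_neq0 : D%:Z != 0 by lia.
    by apply: (mulfI D_neq0); rewrite -xa aE mulrC.
  have D_neq0 : D%:Z != 0 by lia.
  have : x1 = - x0 by apply: (mulfI D_neq0); rewrite -xa aE; ring.
  by lia.
have hk k : h k = h 0%N - x 0%N *+ k.
  elim: k => [|k IHk]; first by rewrite mulr0n subr0.
  have xk : x k = x 0%N by elim: k {IHk} => // k <-; rewrite xS.
  by rewrite mulrSr opprD addrA -IHk -xk /x; ring.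
have := hk n; rewrite -[n in h n]add0n hn => /(congr1 (fun z => h 0%N - z)).
rewrite subrr opprB addrC subrK => /esym/eqP; rewrite mulrn_eq0 => /orP[/eqP n0|].
  by rewrite n0 in n_gt0.
have k1 : (0 < 1 < n)%N by lia.
by rewrite subr_eq0 eq_sym => h01; have := h_neq 0 1 k1; rewrite h01.
Qed.

Lemma no_shifted_cycle : False.
Proof.
have [i /andP[D_a a_D]] := exists_drop_sum.
have x2 j : h j.+2 <> h j by apply/eqP; rewrite -addn2 h_neq//; lia.
have x3 j : h j.+3 <> h j by apply/eqP; rewrite -addn3 h_neq//; lia.
suff /negP : ~~ survives 6 (Z.of_nat D) (Z_of_int (x i)) (Z_of_int (x i.+1)) (Z_of_int (a i.+1)).
  apply; apply: (@survives_orbit _ _ (fun j => Z_of_int (x j)) (fun j => Z_of_int (a j))).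
  - by move: D_gt0; clear; lia.
  - by move=> j; have := h_step j j.+1; rewrite /x /a; clear; lia.
  - by move=> j; rewrite /x /a; clear; lia.
  - by move=> j; have := h_small j j.+1; rewrite /x /a; clear; lia.
  - by move=> j; have := h_small' j j.+1; rewrite /x /a; clear; lia.
  - by move=> j; have := x2 j; rewrite /x; clear; lia.
  - by move=> j; have := x3 j; rewrite /x; clear; lia.
apply: (@triple_not_survives D n (a i) _ _ _ (x i.+2) (h i.+1 - h i.+3)).
all: rewrite ?/x ?/a.
- by [].
- by [].
- exact: h_step.
- exact: h_step.
- by have := h_step i i.+2; rewrite /x /a => <-; ring.
- by ring.
- by rewrite addrA subrK subr_eq0 eq_sym -addn2 h_neq//; lia.
- by rewrite (_ : _ + (h i - _) = h i *+ 2 + 1); last ring.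
- by rewrite (_ : _ + (h i.+1 - _) = h i.+1 *+ 2 + 1); last ring.
- by have := sum_dvd 1 i; rewrite addn1; apply; lia.
- rewrite (_ : _ - (h i.+1 - _) = h i + h (i + 2)%N + 1); last by rewrite addn2; ring.
  by apply: sum_dvd; lia.
- by [].
- exact: h_small'.
- by [].
Qed.

End Cycle.

(** * From rational to integral cycles *)

Lemma denq_dvd (x : rat) (k m : int) : x * k%:~R = m%:~R -> (denq x %| k)%Z.
Proof.
move=> xk; have den_k : (denq x %| k * numq x)%Z.
  apply/dvdzP; exists m; apply: (@intr_inj rat).
  by rewrite !rmorphM /= numqE -xk; ring.
by rewrite -(@Gauss_dvdzl _ _ (numq x))// /coprimez gcdzC; apply: coprime_num_den.
Qed.

Lemma denq_sqr (x : rat) : denq (x ^+ 2) = denq x ^+ 2.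
Proof.
have xE : x ^+ 2 = (numq x ^+ 2)%:~R / (denq x ^+ 2)%:~R.
  by rewrite !rmorphXn -expr_div_n divq_num_den.
rewrite xE coprimeq_den.
  by rewrite expf_eq0 (negPf (denq_neq0 x)) andbF ger0_norm ?exprn_ge0 ?denq_ge0.
by rewrite !abszX coprimeXl// coprimeXr// coprime_num_den.
Qed.

Lemma logn_denqD p (x y : rat) :
  (logn p `|denq (x + y)| <= maxn (logn p `|denq x|) (logn p `|denq y|))%N.
Proof.
have den_gt0 (z : rat) : (0 < `|denq z|)%N by rewrite absz_gt0 denq_neq0.
rewrite -logn_lcm//; apply: dvdn_leq_log; first by rewrite lcmn_gt0 !den_gt0.
have /dvdnP[k kE] := dvdn_lcml `|denq x| `|denq y|.
have /dvdnP[l lE] := dvdn_lcmr `|denq x| `|denq y|.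
set L := lcmn _ _ in kE lE *.
have : (denq (x + y) %| L%:Z)%Z.
  apply: (denq_dvd _ _ (k%:Z * numq x + l%:Z * numq y)).
  have -> : (x + y) * L%:~R = x * L%:~R + y * L%:~R by ring.
  rewrite {1}kE lE !PoszM !absz_denq !rmorphD !rmorphM /= !numqE; ring.
by rewrite dvdzE.
Qed.

(** At a prime p, let e_i and f be the exponents of p in the denominators of
    z_i and c.  Among z_(i+1), z_i^2 and c each exponent is at most the maximum
    of the other two.  For the largest e_i this gives 2 e_i <= f (or all
    exponents vanish); then e_(i+1) <= f / 2 < f, so f <= 2 e_i for every i. *)
Lemma periodic_denq (c : rat) (n : nat) (z : nat -> rat) :
    (0 < n)%N -> (forall i, z i.+1 = z i ^+ 2 + c) ->
    (forall i, z (i + n)%N = z i) ->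
  forall i, (`|denq c| = `|denq (z i)| ^ 2)%N.
Proof.
move=> n_gt0 zS zn i.
have den_gt0 (y : rat) : (0 < `|denq y|)%N by rewrite absz_gt0 denq_neq0.
apply: eqn_from_log; rewrite ?expn_gt0 ?den_gt0// => p.
rewrite lognX; set f := logn p `|denq c|; pose e j := logn p `|denq (z j)|.
rewrite -/(e i).
have eD x y : (logn p `|denq (x - y)| <= maxn (logn p `|denq x|) (logn p `|denq y|))%N.
  by have := logn_denqD p x (- y); rewrite denqN.
have e2 j : logn p `|denq (z j ^+ 2)| = (2 * e j)%N.
  by rewrite denq_sqr abszX lognX.
have f_le j : (f <= maxn (e j.+1) (2 * e j))%N.
  rewrite -e2; have -> : f = logn p `|denq (z j.+1 - z j ^+ 2)|.
    by rewrite zS addrC addKr.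
  exact: eD.
have e_le j : (2 * e j <= maxn (e j.+1) f)%N.
  rewrite -e2; have -> : z j ^+ 2 = z j.+1 - c by rewrite zS addrK.
  exact: eD.
have en j : e (j + n)%N = e j by rewrite /e zn.
have [j0 max_j0] : exists j0, forall j, (e j <= e j0)%N.
  exists [arg max_(j > Ordinal n_gt0) e j]%N.
  case: arg_maxnP => //= j0 _ max_j0 j.
  rewrite (divn_eq j n) addnC periodicM//.
  exact: (max_j0 (Ordinal (ltn_pmod j n_gt0))).
have := e_le j0; have := max_j0 j0.+1; have := max_j0 i; have := max_j0 i.+1.
have := f_le i; have := e_le i.
by clear; lia.
Qed.

(** For M the largest |m_i|, M^2 <= d M + |p| <= 10^4 M + 10^8, and 16180 is the
    integral part of the positive root of M^2 = 10^4 M + 10^8. *)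
Lemma absz_orbit_le (d : nat) (p : int) (n : nat) (m : nat -> int) :
    Z.le (Z.of_nat d) 10000 -> Z.le (Z.of_nat `|p|) 100000000 ->
    (0 < n)%N -> (forall i, m (i + n)%N = m i) ->
    (forall i, d%:Z * m i.+1 = m i ^+ 2 + p) ->
  forall i, Z.le (Z.of_nat `|m i|) 16180.
Proof.
move=> d_le p_le n_gt0 mn mS i.
have [j0 max_j0] : exists j0, forall j, (`|m j| <= `|m j0|)%N.
  exists [arg max_(j > Ordinal n_gt0) `|m j|%N]%N.
  case: arg_maxnP => //= j0 _ max_j0 j.
  rewrite (divn_eq j n) addnC periodicM//.
  exact: (max_j0 (Ordinal (ltn_pmod j n_gt0))).
have := max_j0 i; have := max_j0 j0.+1; have := mS j0.
move: d_le p_le; clear; move: (m j0) (m j0.+1) (m i) => M m1 m0 d_le p_le E m1_le m0_le.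
suff : Z.le (Z.of_nat `|M|) 16180 by lia.
have {}E : Z.mul (Z.of_nat d) (Z_of_int m1) =
           Z.add (Z.mul (Z_of_int M) (Z_of_int M)) (Z_of_int p).
  by move: E; rewrite expr2; lia.
have {}m1_le : Z.le (Z.abs (Z_of_int m1)) (Z.abs (Z_of_int M)) by lia.
have {}p_le : Z.le (Z.abs (Z_of_int p)) 100000000 by lia.
suff : Z.le (Z.abs (Z_of_int M)) 16180 by lia.
move: (Z_of_int M) (Z_of_int m1) (Z_of_int p) (Nat2Z.is_nonneg d) E m1_le p_le d_le.
clear; move: (Z.of_nat d) => {}d M m1 p; nia.
Qed.

(** Sums of two points divide d^n.  Were they all odd, so would be
    (m_0 + m_1) + (m_1 + m_2) + (m_0 + m_2), which is even. *)
Lemma even_denominator (d : nat) (p : int) (n : nat) (m : nat -> int) :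
    (2 < n)%N -> (forall i, m (i + n)%N = m i) ->
    (forall i k, (0 < k < n)%N -> m (i + k)%N != m i) ->
    (forall i, d%:Z * m i.+1 = m i ^+ 2 + p) ->
  ~~ odd d.
Proof.
move=> n_gt2 mn m_neq mS; apply/negP => d_odd.
have odd_sum i k : (0 < k < n)%N -> odd `|(m i + m (i + k)%N)%R|.
  move=> k_n; apply: (@dvdn_odd _ (d ^ n)); last by rewrite oddX d_odd orbT.
  apply: (cycle_factor_dvd n d (fun i => m i - m (i + k)%N)
                               (fun i => m i + m (i + k)%N)) => [|j|j|j|].
  - exact: ltn_trans n_gt2.
  - by rewrite addnAC !mn.
  - by rewrite addnAC !mn.
  - by rewrite addSn mulrBr !mS; ring.
  - by rewrite subr_eq0 eq_sym m_neq.
have k1 : (0 < 1 < n)%N by lia.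
have k2 : (0 < 2 < n)%N by lia.
have := odd_sum 0%N 1%N k1; have := odd_sum 1%N 1%N k1; have := odd_sum 0%N 2%N k2.
by rewrite !add0n addn1; clear; lia.
Qed.

Lemma no_integral_cycle (d : nat) (p : int) (n : nat) (m : nat -> int) :
    (0 < d)%N -> Z.le (Z.of_nat d) 10000 -> Z.le (Z.of_nat `|p|) 100000000 ->
    (3 < n)%N -> (forall i, m (i + n)%N = m i) ->
    (forall i k, (0 < k < n)%N -> m (i + k)%N != m i) ->
    (forall i, d%:Z * m i.+1 = m i ^+ 2 + p) ->
    (forall i, coprime d `|m i|) ->
  False.
Proof.
move=> d_gt0 d_le p_le n_gt3 mn m_neq mS co_m.
have n_gt0 : (0 < n)%N by apply: ltn_trans n_gt3.
have n_gt2 : (2 < n)%N by apply: ltn_trans n_gt3.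
have m_le := absz_orbit_le d p n m d_le p_le n_gt0 mn mS.
have := even_denominator d p n m n_gt2 mn m_neq mS.
rewrite -dvdn2 => /dvdnP[D dE].
have m_odd i : exists hi : int, m i = hi *+ 2 + 1.
  have : odd `|m i|.
    by rewrite -coprime2n; apply: coprime_dvdl (co_m i); rewrite dE dvdn_mull.
  by exists ((m i - 1) %/ 2)%Z; lia.
pose h i : int := ((m i - 1) %/ 2)%Z.
have mE i : m i = h i *+ 2 + 1.
  by have [hi mi] := m_odd i; rewrite /h mi; clear; lia.
apply: (@no_shifted_cycle D n h) => //.
- by move: d_gt0; rewrite dE; clear; lia.
- by move: d_le; rewrite dE; clear; lia.
- by move=> i; rewrite /h mn.
- by move=> i k k_n; apply: contraNneq (m_neq i k k_n) => hE; rewrite !mE hE.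
- move=> i j; have := mS i; have := mS j; rewrite dE !mE; clear; move: (h i) (h j) (h i.+1) (h j.+1).
  by move=> h0 h1 h2 h3; rewrite !expr2; lia.
- move=> i; rewrite -mE; apply: coprime_dvdl (co_m i); rewrite dE; exact: dvdn_mulr.
- by move=> i j; have := m_le i; have := m_le j; rewrite !mE; clear; lia.
- by move=> i j; have := m_le i; have := m_le j; rewrite !mE; clear; lia.
Qed.

Lemma height_le (R : realType) (c : rat) :
    height R c <= 8%:R * ln (10%:R : R) ->
  Z.le (Z.of_nat `|numq c|) 100000000 /\ Z.le (Z.of_nat `|denq c|) 100000000.
Proof.
rewrite /height => hc.
have max_gt0 : 0 < Num.max `|numq c| `|denq c| by rewrite lt_max !normr_gt0 denq_neq0 orbT.
have : (Num.max `|numq c| `|denq c|)%:~R <= (10%:Z ^+ 8)%:~R :> R.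
  rewrite -ler_ln ?posrE ?ltr0z//.
  by rewrite rmorphXn lnXn ?ltr0z// -mulr_natl.
rewrite ler_int ge_max => /andP[p_le q_le].
have pow8 : Z_of_int (10%:Z ^+ 8) = Z.pow 10 8.
  by rewrite rmorphXn; vm_compute.
move: pow8 p_le q_le; clear; move: (_ ^+ 8) => b bE p_le q_le.
by split; lia.
Qed.

Lemma no_rational_cycle (R : realType) (c z0 : rat) (n : nat) :
    height R c <= 8%:R * ln (10%:R : R) -> (3 < n)%N ->
  ~ exact_period (phi c) n (Some z0).
Proof.
move=> /height_le[p_le q_le] n_gt3 [_ per exact].
pose z i := iter i (fun y => y ^+ 2 + c) z0.
have iterE i : iter i (phi c) (Some z0) = Some (z i).
  by elim: i => [//|i IHi]; rewrite iterS IHi.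
have n_gt0 : (0 < n)%N by apply: ltn_trans n_gt3.
have zn i : z (i + n)%N = z i.
  have zn0 : z n = z0 by move: per; rewrite iterE => -[].
  by rewrite /z iterD -/(z n) zn0.
have z_neq i k : (0 < k < n)%N -> z (i + k)%N != z i.
  move=> k_n; apply/eqP => zik.
  apply: (exact k k_n); rewrite iterE; congr Some.
  have i_le : (i <= i * n)%N by rewrite leq_pmulr.
  have zD a b : z (a + b)%N = iter a (fun y => y ^+ 2 + c) (z b) by rewrite /z iterD.
  rewrite -(periodicM _ z n k i zn) -{1}(subnK i_le) addnCA zD [(k + i)%N]addnC zik.
  by rewrite -zD subnK// -[(i * n)%N]add0n periodicM.
have zS i : z i.+1 = z i ^+ 2 + c by [].
have denE := periodic_denq c n z n_gt0 zS zn.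
clearbody z; clear iterE.
set d := `|denq (z 0%N)|%N.
have den_z i : denq (z i) = d%:Z.
  have /eqP := denE i; rewrite (denE 0%N) eqn_exp2r// => /eqP dE.
  by rewrite /d dE absz_denq.
have zE i : z i = (numq (z i))%:~R / d%:~R.
  by rewrite -[LHS]divq_num_den den_z.
have d_gt0 : (0 < d)%N by rewrite absz_gt0 denq_neq0.
apply: (no_integral_cycle d (numq c) n (fun i => numq (z i))) => //.
- have := denE 0%N; rewrite -/d => qE; move: q_le; rewrite qE; clear.
  by move: d => d; rewrite -mulnn; nia.
- by move=> i; rewrite zn.
- move=> i k k_n; apply: contraNneq (z_neq i k k_n) => numE.
  by rewrite zE numE -zE.
- move=> i; apply: (@intr_inj rat).
  have den_c : denq c = d%:Z * d%:Z by rewrite -PoszM mulnn -denE absz_denq.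
  rewrite !(rmorphM, rmorphD, rmorphXn) /= !numqE !den_z den_c zS rmorphM /=.
  ring.
- by move=> i; have := coprime_num_den (z i); rewrite den_z coprime_sym.
Qed.

Theorem proposition1 (R : realType) :
  ~ (exists c : rat,
       height R c <= 8%:R * ln (10%:R : R) /\
       exists (alpha : P1Q) (n : nat),
         (3 < n)%N /\ exact_period (phi c) n alpha).
Proof.
move=> [c [c_le [[z0|] [n [n_gt3 per]]]]].
  exact: no_rational_cycle c_le n_gt3 per.
case: per => _ _ /(_ 1%N); apply; last by [].
by apply: leq_trans n_gt3.
Qed.
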